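(* Let $n\ge3$ and $\lambda,\mu\in S_{2n}$ with $\mathrm{par}(\lambda)=\mathrm{par}(\mu)=(a,b)$. (1) If $a=b=n$, then $\mathrm{class}(\lambda)=\mathrm{class}(\mu)$. (2) If $a=b=n-1$, then $\mathrm{class}(\lambda)=\mathrm{class}(\mu)$ if and only if $\{\lambda_n,\lambda_{n+1}\}=\{\mu_n,\mu_{n+1}\}$. (3) If $1<a,b\le n-1$ and $(a,b)\ne(n-1,n-1)$, then $\mathrm{class}(\lambda)=\mathrm{class}(\mu)$ if and only if $\lambda$ and $\mu$ are friends. (4) If exactly one of $a=1$, $b=1$ holds, then $\mathrm{class}(\lambda)=\mathrm{class}(\mu)$ if and only if there exists $\mu'\in\mathrm{fam}(\mu)$ such that $\lambda$ and $\mu'$ are friends. (5) If $a=b=1$, then $\mathrm{class}(\lambda)=\mathrm{class}(\mu)$ if and only if $\mu\in\mathrm{fam}(\lambda)$.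
   Context: A Dyck path of size $n$ is a word in $\mathtt{u},\mathtt{d}$ with $n$ of each letter whose every prefix has at least as many $\mathtt{u}$'s as $\mathtt{d}$'s; $\mathcal{D}_n$ is their set. The tunneling $\tau_D\in S_{2n}$ of $D$ is the fixed-point-free involution pairing each up-step position with the position of its matching down-step. For $\sigma\in S_{2n}$, $\sigma_k=\sigma(k)$, $\sigma_{[k]}=\{\sigma_1,\dots,\sigma_k\}$, and $[a,b]$ is the set of integers from $a$ to $b$; the $\sigma$-path $\sigma(D)$ has $\sigma(D)_k=\mathtt{u}$ if $\tau_D(\sigma_k)\notin\sigma_{[k]}$ and $\mathtt{d}$ otherwise. $\lambda\sim\mu$ iff $\lambda(D)=\mu(D)$ for all $D\in\mathcal{D}_n$; $\mathrm{class}(\sigma)$ is the class of $\sigma$. The parity $\mathrm{par}(\sigma)=(a,b)$: $a$ is the smallest positive integer with $\sigma_a\not\equiv\sigma_{a+1}\pmod2$, $b$ is the smallest positive integer with $\sigma_{2n+1-b}\not\equiv\sigma_{2n-b}\pmod2$. The family of $\lambda$ is $\mathrm{fam}(\lambda)=\{\mu\in S_{2n}:\lambda_{[2]}=\mu_{[2]}\text{ and }\lambda_i=\mu_i\text{ for all }i\in[3,2n-2]\}$. Two permutations $\lambda,\mu$ are friends if $\mathrm{par}(\lambda)=\mathrm{par}(\mu)=(a,b)$, $\lambda_{[a]}=\mu_{[a]}$ (as sets), and $\lambda_i=\mu_i$ for all $i\in[a+1,2n-b]$. *)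

(* Defs.v *)
From HB Require Import structures.
From mathcomp Require Import all_boot all_order all_fingroup.
From mathcomp Require Import zify.

Set Implicit Arguments.
Unset Strict Implicit.
Unset Printing Implicit Defensive.

Local Notation u := true (only parsing).
Local Notation d := false (only parsing).

Definition dyck_word (w : seq bool) : bool :=
  (count_mem u w == count_mem d w) &&
  all (fun k => count_mem d (take k w) <= count_mem u (take k w))
      (iota 0 (size w).+1).

Definition dyck (n : nat) : {set (2 * n).-tuple bool} :=
  [set D : (2 * n).-tuple bool |
     [&& count_mem u D == n, count_mem d D == n & dyck_word D]].

(* The up-step at position i matches the down-step at position j when
   D = A u B d C with these u, d at positions i, j and B a Dyck path. *)
Definition matching (m : nat) (D : m.-tuple bool) (i j : 'I_m) : bool :=
  [&& i < j, tnth D i == u, tnth D j == d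
    & dyck_word (take (j - i.+1) (drop i.+1 D))].

Definition tunneling_fun (m : nat) (D : m.-tuple bool) (i : 'I_m) : 'I_m :=
  odflt i [pick j | matching D i j || matching D j i].

Lemma dyck_word_prefix (w : seq bool) k :
  dyck_word w -> count_mem d (take k w) <= count_mem u (take k w).
Proof.
case/andP=> /eqP cw /allP h.
have [kw|kw] := leqP k (size w); first by apply: h; rewrite mem_iota; lia.
by rewrite take_oversize ?cw // ltnW.
Qed.

Lemma dyck_word_suffix (w : seq bool) k :
  dyck_word w -> count_mem u (drop k w) <= count_mem d (drop k w).
Proof.
move=> hw; have := dyck_word_prefix k hw; case/andP: hw => /eqP.
by rewrite -{1 2}[w](cat_take_drop k) !count_cat; lia.
Qed.

Lemma matching_inj_r m (D : m.-tuple bool) (i j j' : 'I_m) :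
  matching D i j -> matching D i j' -> j = j'.
Proof.
wlog lt_jj : j j' / j < j'.
  by move=> wl h h'; case: (ltngtP j j') => [/wl->|/wl->|/val_inj].
case/and4P=> ij _ /eqP Dj /andP[/eqP bal _] /and4P[ij' _ _ hw'].
have := dyck_word_prefix (j - i.+1).+1 hw'.
rewrite take_takel; last by lia.
rewrite (take_nth d); last by rewrite size_drop size_tuple; have := ltn_ord j; lia.
rewrite nth_drop subnKC // -tnth_nth Dj -cats1 !count_cat bal /=; lia.
Qed.

Lemma matching_inj_l m (D : m.-tuple bool) (i i' j : 'I_m) :
  matching D i j -> matching D i' j -> i = i'.
Proof.
wlog lt_ii : i i' / i' < i.
  by move=> wl h h'; case: (ltngtP i i') => [/wl->|/wl->|/val_inj].
case/and4P=> ij /eqP Di _ /andP[/eqP bal _] /and4P[ij' _ _ hw'].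
have := dyck_word_suffix (i - i'.+1) hw'.
rewrite -[j - _](subnK (_ : i - i'.+1 <= _)); last by lia.
rewrite -take_drop drop_drop subnK //.
rewrite (drop_nth d) ?size_tuple // -tnth_nth Di.
have -> : j - i'.+1 - (i - i'.+1) = (j - i.+1).+1 by lia.
by rewrite /= bal add1n ltnn.
Qed.

Lemma matching_path m (D : m.-tuple bool) (i j k : 'I_m) :
  matching D i j -> matching D j k = false.
Proof.
case/and4P=> _ _ /eqP Dj _; apply/negP; case/and4P=> _.
by rewrite Dj.
Qed.

Lemma tunneling_funK m (D : m.-tuple bool) : involutive (tunneling_fun D).
Proof.
move=> i; rewrite {2}/tunneling_fun; case: pickP => [j hj|none] /=; last first.
  by rewrite /tunneling_fun; case: pickP => // j; rewrite none.
rewrite /tunneling_fun; case: pickP => [k hk|/(_ i)] /=; last by rewrite orbC hj.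
case/orP: hj => hj; case/orP: hk => hk.
- by rewrite (matching_path _ hj) in hk.
- exact: matching_inj_l hk hj.
- exact: matching_inj_r hk hj.
- by rewrite (matching_path _ hk) in hj.
Qed.

Definition tunneling (m : nat) (D : m.-tuple bool) : 'S_m :=
  perm (inv_inj (@tunneling_funK m D)).

(* Positions and values live in 'I_m, hence are 0-based: the i-th position,
   counted from 1, is the ordinal of value i.-1. *)
Definition initial_set (m : nat) (s : 'S_m) (k : nat) : {set 'I_m} :=
  [set s i | i : 'I_m & i.+1 <= k].

(* 1-based one-line notation; the value 0 is taken only outside [1, m]. *)
Definition entry (m : nat) (s : 'S_m) (k : nat) : nat :=
  if k is k'.+1 then (if insub k' is Some i then (s i).+1 else 0) else 0.

Definition sigma_path (m : nat) (s : 'S_m) (D : m.-tuple bool) : m.-tuple bool :=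
  [tuple if tunneling D (s k) \notin initial_set s k.+1 then u else d | k < m].

Definition path_equiv (n : nat) (lambda mu : 'S_(2 * n)) : bool :=
  [forall D in dyck n, sigma_path lambda D == sigma_path mu D].

Definition path_class (n : nat) (s : 'S_(2 * n)) : {set 'S_(2 * n)} :=
  [set mu | path_equiv s mu].

(* For n > 0 both searches succeed, see par_leftP and par_rightP. *)
Definition par_left (n : nat) (s : 'S_(2 * n)) : nat :=
  (find (fun a => entry s a != entry s a.+1 %[mod 2])
        (iota 1 (2 * n).-1)).+1.

Definition par_right (n : nat) (s : 'S_(2 * n)) : nat :=
  (find (fun b => entry s (2 * n + 1 - b) != entry s (2 * n - b) %[mod 2])
        (iota 1 (2 * n).-1)).+1.

Definition par (n : nat) (s : 'S_(2 * n)) : nat * nat :=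
  (par_left s, par_right s).

Definition fam (n : nat) (lambda : 'S_(2 * n)) : {set 'S_(2 * n)} :=
  [set mu : 'S_(2 * n) | (initial_set lambda 2 == initial_set mu 2) &&
     [forall i : 'I_(2 * n), (3 <= i.+1 <= 2 * n - 2) ==> (lambda i == mu i)]].

Definition friends (n : nat) (lambda mu : 'S_(2 * n)) : Prop :=
  let: (a, b) := par lambda in
  [/\ par mu = (a, b),
      initial_set lambda a = initial_set mu a
    & forall i : 'I_(2 * n), a + 1 <= i.+1 <= 2 * n - b -> lambda i = mu i].

Lemma unbalanced_prefix (w : seq bool) : count_mem u w < count_mem d w ->
  exists k, [/\ k < size w, nth d w k = d & dyck_word (take k w)].
Proof.
move=> lt_w.
pose P k := (k <= size w) && (count_mem u (take k w) < count_mem d (take k w)).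
have exP : exists k, P k by exists (size w); rewrite /P leqnn take_size.
case: (ex_minnP exP) => -[|k] /andP[kw lt_k] min_k; first by rewrite take0 in lt_k.
have le_k j : j <= k -> count_mem d (take j w) <= count_mem u (take j w).
  by move=> jk; rewrite leqNgt; apply/negP => lt_j; have := min_k j; rewrite /P lt_j; lia.
have le_kk := le_k k (leqnn k).
move: lt_k (le_kk); rewrite (take_nth d) // -cats1 !count_cat /=.
case e: (nth d w k) => /= lt_k le_kk'; first by lia.
exists k; split=> //; apply/andP; split; first by apply/eqP => /=; lia.
apply/allP => j; rewrite mem_iota (size_takel (ltnW kw)) => jk.
by rewrite take_takel ?le_k //; lia.
Qed.

Lemma unbalanced_suffix (w : seq bool) : count_mem d w < count_mem u w ->
  exists k, [/\ k < size w, nth d w k = u & dyck_word (drop k.+1 w)].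
Proof.
move=> lt_w.
pose P k := count_mem d (drop k w) < count_mem u (drop k w).
have exP : exists k, P k by exists 0; rewrite /P drop0.
have ubP k : P k -> k <= size w.
  by rewrite leqNgt => Pk; apply/negP => kw; move: Pk; rewrite /P drop_oversize // ltnW.
case: (ex_maxnP exP ubP) => k Pk max_k.
have kw : k < size w.
  by rewrite ltnNge; apply/negP => kw; move: Pk; rewrite /P drop_oversize.
have le_k j : k < j -> count_mem u (drop j w) <= count_mem d (drop j w).
  by move=> kj; rewrite leqNgt; apply/negP => /max_k; lia.
have le_kk := le_k k.+1 (leqnn _).
move: Pk (le_kk); rewrite /P (drop_nth d kw) /=.
case e: (nth d w k) => /= lt_k le_kk'; last by lia.
have bal : count_mem u (drop k.+1 w) = count_mem d (drop k.+1 w) by move=> /=; lia.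
exists k; split=> //; apply/andP; split; first exact/eqP.
apply/allP => j _; have := le_k (j + k.+1); rewrite -drop_drop.
by move: bal; rewrite -{1 2}[drop k.+1 w](cat_take_drop j) !count_cat; lia.
Qed.

Lemma matching_exists m (D : m.-tuple bool) (i : 'I_m) :
  dyck_word D -> exists j, matching D i j || matching D j i.
Proof.
move=> hD; have im := ltn_ord i; case Di: (tnth D i).
- have := dyck_word_suffix i hD.
  rewrite (drop_nth d) ?size_tuple // -tnth_nth Di /= => lt_i.
  have [|k []] := @unbalanced_prefix (drop i.+1 D); first by move=> /=; lia.
  rewrite size_drop size_tuple => km; rewrite nth_drop => Dk hk.
  have jm : i.+1 + k < m by lia.
  exists (Ordinal jm); apply/orP; left; apply/and4P; split => /=; first by lia.
  + by rewrite Di.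
  + by rewrite (tnth_nth d) Dk.
  + by rewrite addKn.
- have := dyck_word_prefix i.+1 hD.
  rewrite (take_nth d) ?size_tuple // -tnth_nth Di -cats1 !count_cat /= => lt_i.
  have [|k []] := @unbalanced_suffix (take i D); first by move=> /=; lia.
  rewrite size_takel ?size_tuple; last exact: ltnW.
  move=> ki.
  rewrite nth_take // => Dk hk.
  have km : k < m by lia.
  exists (Ordinal km); apply/orP; right; apply/and4P; split => //=.
  + by rewrite (tnth_nth d) Dk.
  + by rewrite Di.
  + by rewrite take_drop subnK.
Qed.

Lemma tunneling_matching m (D : m.-tuple bool) (i : 'I_m) : dyck_word D ->
  matching D i (tunneling D i) || matching D (tunneling D i) i.
Proof.
move=> /(matching_exists i)[j hj]; rewrite permE /tunneling_fun.
by case: pickP => [k|/(_ j)] //; rewrite hj.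
Qed.

Lemma entryE m (s : 'S_m) (i : 'I_m) : entry s i.+1 = (s i).+1.
Proof. by rewrite /entry valK. Qed.

Lemma parity_change n (s : 'S_(2 * n)) : 0 < n ->
  exists2 k, 0 < k < 2 * n & entry s k != entry s k.+1 %[mod 2].
Proof.
move=> n0; pose P k := entry s k != entry s k.+1 %[mod 2].
case: (boolP (has P (iota 1 (2 * n).-1))) => [/hasP[k]|/hasPn noP].
  by rewrite mem_iota => kn Pk; exists k => //; lia.
have const k : k < 2 * n -> entry s k.+1 = entry s 1 %[mod 2].
  elim: k => // k IHk kn; rewrite -IHk; last by lia.
  have := noP k.+1; rewrite mem_iota /P negbK => /(_ _)/eqP -> //; lia.
have p0 : 0 < 2 * n by lia.
have p1 : 1 < 2 * n by lia.
have val (x : 'I_(2 * n)) : x.+1 = entry s 1 %[mod 2].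
  by rewrite -(const (s^-1%g x)) // entryE permKV.
by have := etrans (val (Ordinal p0)) (esym (val (Ordinal p1))).
Qed.

Lemma find_iota1P (P : pred nat) m k : 0 < k < m -> P k ->
  let a := (find P (iota 1 m.-1)).+1 in
  [/\ 0 < a < m, P a & forall c, 0 < c < a -> ~~ P c].
Proof.
move=> km Pk a.
have hasP : has P (iota 1 m.-1) by apply/hasP; exists k => //; rewrite mem_iota; lia.
have lt_a : a.-1 < m.-1 by move: hasP; rewrite has_find size_iota.
split; first by rewrite /a in lt_a *; lia.
  by have := nth_find 0 hasP; rewrite nth_iota.
move=> c ca; have lt_c : c.-1 < find P (iota 1 m.-1) by rewrite /a in ca; lia.
have := before_find 0 lt_c; rewrite nth_iota; last by rewrite /a in lt_a; lia.
by rewrite add1n prednK => [->|]; lia.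
Qed.

Lemma par_leftP n (s : 'S_(2 * n)) (a := par_left s) : 0 < n ->
  [/\ 0 < a < 2 * n, entry s a != entry s a.+1 %[mod 2]
    & forall c, 0 < c < a -> entry s c = entry s c.+1 %[mod 2]].
Proof.
move=> n0; have [k kn Pk] := parity_change s n0.
pose P c := entry s c != entry s c.+1 %[mod 2].
have [an Pa min_a] := @find_iota1P P _ _ kn Pk.
by split=> // c /min_a; rewrite negbK => /eqP.
Qed.

Lemma par_rightP n (s : 'S_(2 * n)) (b := par_right s) : 0 < n ->
  [/\ 0 < b < 2 * n,
      entry s (2 * n + 1 - b) != entry s (2 * n - b) %[mod 2]
    & forall c, 0 < c < b ->
        entry s (2 * n + 1 - c) = entry s (2 * n - c) %[mod 2]].
Proof.
move=> n0; have [k kn Pk] := parity_change s n0.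
pose Q b := entry s (2 * n + 1 - b) != entry s (2 * n - b) %[mod 2].
have Qk : Q (2 * n - k).
  rewrite /Q eq_sym.
  have -> : 2 * n - (2 * n - k) = k by lia.
  by have -> : 2 * n + 1 - (2 * n - k) = k.+1 by lia.
have kn' : 0 < 2 * n - k < 2 * n by lia.
have [bn Qb min_b] := @find_iota1P Q _ _ kn' Qk.
by split=> // c /min_b; rewrite negbK => /eqP.
Qed.

(* Main.v *)
Require Import Defs.
From mathcomp Require Import all_boot all_order all_fingroup all_algebra.
From mathcomp Require Import zify ring.

(* The number of down-steps among the first k steps of s(D) is the number of
   arcs of D inside A_k = {s_1, ..., s_k}, so s ~ t iff A_k(s) and A_k(t)
   contain equally many arcs of every Dyck path, for every k.  If A_k or its
   complement has a single parity (k <= a or k >= 2n - b), that number depends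
   only on k, since arcs join positions of different parities.  Otherwise,
   inserting a peak before or after one step of a Dyck word switches the arcs
   {i, i+1}, {i+2, j} to {i+1, i+2}, {i, j}; the change in the number of arcs
   inside A is (f i - f (i+2)) (f (i+1) - f j), f the indicator of A.  Summing
   such identities determines A up to complement.  Hence s ~ t iff for all
   a < k < 2n - b the sets A_k(s), A_k(t) are equal, or k = n and they are
   complementary; the five cases follow. *)

Set Implicit Arguments.
Unset Strict Implicit.
Unset Printing Implicit Defensive.

(** * Dyck words by height, and insertion of Dyck factors *)

(** The path starts at height [h], never goes below 0 and ends at 0. Letting the starting height
    vary makes induction along the word possible. *)
Fixpoint dyck_from (h : nat) (w : seq bool) : bool :=
  match w with
  | [::] => h == 0
  | true :: w' => dyck_from h.+1 w'
  | false :: w' => (0 < h) && dyck_from h.-1 w'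
  end.

Lemma dyck_fromP h w :
  reflect (h + count_mem true w = count_mem false w /\
           forall k, count_mem false (take k w) <= h + count_mem true (take k w))
          (dyck_from h w).
Proof.
elim: w h => [|[] w IHw] h /=.
- by apply: (iffP eqP) => [->|[]]; first split; lia.
- apply: (iffP (IHw _)) => -[/= e le]; split; try by move=> /=; lia.
    by case=> [|k] //=; have /= := le k; lia.
  by move=> k; have /= := le k.+1; lia.
- apply: (iffP andP) => [[h0 /IHw[/= e le]]|[/= e le]].
    split; first by lia.
    by case=> [|k] //=; have /= := le k; lia.
  have h0 : 0 < h by have := le 1; rewrite /= take0 /=; lia.
  split=> //; apply/IHw; split; first by move=> /=; lia.
  by move=> k /=; have /= := le k.+1; lia.
Qed.

Lemma dyck_wordE w : dyck_word w = dyck_from 0 w.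
Proof.
apply/idP/dyck_fromP => [hw|[e le]].
  by split=> [|k]; [case/andP: hw => /eqP-> | rewrite add0n dyck_word_prefix].
apply/andP; split; first by apply/eqP; move: e; rewrite add0n.
by apply/allP => k _; apply: le.
Qed.

(** The prefix [v] descends from [g] to 0, so started [h] higher it arrives at [h], where [w] takes
    over. The height [g] is general for the induction on [v]. *)
Lemma dyck_from_cat g h v w :
  dyck_from g v -> dyck_from (g + h) (v ++ w) = dyck_from h w.
Proof.
elim: v g => [|[] v IHv] g /=; first by move=> /eqP->.
  by rewrite -addSn; apply: IHv.
case/andP=> g0 /IHv <-; have -> : (g + h).-1 = g.-1 + h by lia.
by rewrite addn_gt0 g0.
Qed.

(** A Dyck factor returns to the height at which it starts, so the steps around it keep their
    heights. *)
Lemma dyck_word_insert x v y :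
  dyck_word v -> dyck_word (x ++ v ++ y) = dyck_word (x ++ y).
Proof.
rewrite !dyck_wordE => hv; elim: x 0 => [|[] x IHx] h /=; last by rewrite IHx.
  by rewrite -{1}[h]add0n dyck_from_cat.
exact: IHx.
Qed.

Lemma dyck_word_wrap v : dyck_word v -> dyck_word (true :: v ++ [:: false]).
Proof. by move=> hv; rewrite (dyck_word_insert [:: true]). Qed.

Lemma dyck_word_peaks m : dyck_word (flatten (nseq m [:: true; false])).
Proof. by elim: m => // m; rewrite !dyck_wordE. Qed.

Lemma size_peaks m : size (flatten (nseq m [:: true; false])) = 2 * m.
Proof. by elim: m => //= m ->; lia. Qed.

Lemma count_mem_bool w : count_mem true w + count_mem false w = size w.
Proof. by rewrite -(count_predC (pred1 true)); congr addn; apply: eq_count => -[]. Qed.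

Lemma dyck_word_size w : dyck_word w -> size w = (count_mem true w).*2.
Proof. by case/andP=> /eqP e _; rewrite -count_mem_bool -addnn e. Qed.

Lemma dyck_tuple n w : size w = 2 * n -> dyck_word w ->
  exists2 D : (2 * n).-tuple bool, D \in dyck n & D = w :> seq bool.
Proof.
move=> sw hw; have sw' : size w == 2 * n by apply/eqP.
have cu : count_mem true w = n by have := dyck_word_size hw; rewrite sw; lia.
have cd : count_mem false w = n by have := count_mem_bool w; rewrite sw cu; lia.
by exists (Tuple sw') => //; rewrite inE hw cu cd eqxx.
Qed.

Lemma dyck_dyck_word n (D : (2 * n).-tuple bool) : D \in dyck n -> dyck_word D.
Proof. by rewrite inE => /and3P[]. Qed.

(** * Arcs and their behaviour when a peak is inserted *)

(** Positions are natural numbers here, so that words of different lengths can be compared without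
    casts between ordinal types. *)
Definition arc (w : seq bool) (i j : nat) : Prop :=
  exists x v y, [/\ w = x ++ true :: v ++ false :: y, size x = i,
                    j = i + (size v).+1 & dyck_word v].

Lemma matching_arc m (D : m.-tuple bool) (i j : 'I_m) :
  matching D i j <-> arc D i j.
Proof.
have im := ltn_ord i; have jm := ltn_ord j; split.
  case/and4P=> ij /eqP Di /eqP Dj hv.
  exists (take i D), (take (j - i.+1) (drop i.+1 D)), (drop j.+1 D); split=> //.
  - have -> : false :: drop j.+1 D = drop j D.
      by rewrite [RHS](drop_nth false) ?size_tuple // -tnth_nth Dj.
    have -> : drop j D = drop (j - i.+1) (drop i.+1 D) by rewrite drop_drop subnK.
    rewrite cat_take_drop -{1}[tval D](cat_take_drop i); congr cat.
    by rewrite [LHS](drop_nth false) ?size_tuple // -tnth_nth Di.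
  - by rewrite size_takel // size_tuple ltnW.
  - by rewrite size_takel ?size_drop ?size_tuple; lia.
case=> x [v [y [eD sx ej hv]]].
apply/and4P; split; first by lia.
- by rewrite (tnth_nth false) eD nth_cat sx ltnn subnn.
- rewrite (tnth_nth false) eD nth_cat sx ifF; last by lia.
  have -> : j - i = (size v).+1 by lia.
  by rewrite /= nth_cat ltnn subnn.
- rewrite eD -cat_rcons drop_size_cat ?size_rcons ?sx // take_size_cat //; lia.
Qed.

Lemma cat_eq_split (T : Type) (x y p q : seq T) :
  x ++ y = p ++ q -> size x <= size p -> exists2 z, p = x ++ z & y = z ++ q.
Proof.
elim: x p => [|a x IHx] [|b p] //=.
- by move=> ->; exists [::].
- by move=> -> _; exists (b :: p).
- by case=> -> e; rewrite ltnS => /(IHx _ e)[z -> ->]; exists z.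
Qed.

(** The new index of step [i] after two steps have been inserted at the cut [k]. *)
Definition skip (k i : nat) : nat := if i < k then i else i + 2.

(** The cut lies before the arc, after it, or between its ends. In the last case the peak joins the
    Dyck word under the arc, which stays Dyck by [dyck_word_insert]. *)
Lemma arc_insert x y i j : arc (x ++ y) i j ->
  arc (x ++ [:: true, false & y]) (skip (size x) i) (skip (size x) j).
Proof.
case=> p [v [q [e sp -> hv]]]; rewrite /skip.
have [lt_ix|le_xi] := ltnP i (size x); last first.
  have [|z ep ->] := cat_eq_split e; first by rewrite sp.
  rewrite ifF; last by lia.
  exists (x ++ [:: true, false & z]), v, q; split=> //; first by rewrite -catA.
    by rewrite -sp ep !size_cat /=; lia.
  by lia.
have [|[|c z]] := cat_eq_split (esym e); first by rewrite sp ltnW.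
  by rewrite cats0 => ex; rewrite ex sp ltnn in lt_ix.
rewrite cat_cons => ex [ec e']; rewrite -{}ec in ex.
case: ltnP; rewrite ex size_cat /= sp => le_x.
  have [|[|c' t]] := cat_eq_split e'; first by lia.
    by rewrite cats0 => ez; rewrite ez in le_x; lia.
  rewrite cat_cons => ez [ec _]; rewrite -{}ec in ez.
  exists p, v, (t ++ [:: true, false & y]); split=> //.
  by rewrite ez -!catA /= -!catA.
have [|t ev ey] := cat_eq_split (esym e'); first by lia.
exists p, (z ++ [:: true, false & t]), q; split=> //.
- by rewrite ey -!catA.
- by rewrite ev !size_cat /=; lia.
- by rewrite (@dyck_word_insert z [:: true; false] t) // -ev.
Qed.

Lemma arc_inserted x y : arc (x ++ [:: true, false & y]) (size x) (size x).+1.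
Proof. by exists x, [::], y; split=> //=; lia. Qed.

Lemma tunneling_arc m (D : m.-tuple bool) (i j : 'I_m) :
  arc D i j \/ arc D j i -> tunneling D i = j.
Proof.
move=> hij; have {}hij : matching D i j \/ matching D j i.
  by case: hij => /matching_arc; [left | right].
rewrite permE /tunneling_fun; case: pickP => [k|/(_ j)] /=; last first.
  by case: hij => ->; rewrite ?orbT.
case: hij => hj /orP[] hk.
- exact: matching_inj_r hk hj.
- by rewrite (matching_path _ hk) in hj.
- by rewrite (matching_path _ hj) in hk.
- exact: matching_inj_l hk hj.
Qed.

Lemma tunneling_insert m (D : m.-tuple bool) x y k l (i j : 'I_m) :
  D = x ++ [:: true, false & y] :> seq bool ->
  arc (x ++ y) k l \/ arc (x ++ y) l k ->
  i = skip (size x) k :> nat -> j = skip (size x) l :> nat ->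
  tunneling D i = j.
Proof.
move=> eD h ei ej; apply: tunneling_arc; rewrite eD ei ej.
by case: h => /arc_insert; [left | right].
Qed.

Lemma tunneling_inserted m (D : m.-tuple bool) x y (i j : 'I_m) :
  D = x ++ [:: true, false & y] :> seq bool ->
  i = size x :> nat -> j = (size x).+1 :> nat -> tunneling D i = j.
Proof.
by move=> eD ei ej; apply: tunneling_arc; left; rewrite eD ei ej; apply: arc_inserted.
Qed.

Lemma tunnelingK m (D : m.-tuple bool) : involutive (tunneling D).
Proof. by move=> i; rewrite !permE tunneling_funK. Qed.

(** The word under an arc is a Dyck word, hence of even length. *)
Lemma odd_tunneling m (D : m.-tuple bool) (i : 'I_m) :
  dyck_word D -> odd (tunneling D i) = ~~ odd i.
Proof.
move=> /(tunneling_matching i)/orP[] /matching_arc [x [v [y [_ _ ej]]]] /dyck_word_size sv.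
  by rewrite ej sv; lia.
by rewrite [X in ~~ odd X]ej sv; lia.
Qed.

Lemma tunneling_neq m (D : m.-tuple bool) (i : 'I_m) : dyck_word D -> tunneling D i != i.
Proof. by move=> /(odd_tunneling i) h; apply/eqP => e; move: h; rewrite e; case: odd. Qed.

(* The complementary word is filled with peaks; cutting it at any place i,
   even or odd, is harmless. *)
Lemma dyck_word_with_arc m i j : i < j < 2 * m -> odd (j - i) ->
  exists w, [/\ size w = 2 * m, dyck_word w & arc w i j].
Proof.
move=> ij odd_ij.
pose v := flatten (nseq (j - i)./2 [:: true; false]).
pose w := flatten (nseq (m - (j - i)./2.+1) [:: true; false]).
have sv : size v = (j - i).-1 by rewrite size_peaks; lia.
have sw : size w = 2 * m - (j - i).+1 by rewrite size_peaks; lia.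
exists (take i w ++ (true :: v ++ [:: false]) ++ drop i w); split.
- by rewrite !size_cat /= !size_cat /= size_drop size_takel ?sw ?sv; lia.
- by rewrite dyck_word_insert ?cat_take_drop ?dyck_word_wrap ?dyck_word_peaks.
- exists (take i w), v, (drop i w); split; first by rewrite /= -catA.
  + by rewrite size_takel // sw; lia.
  + by rewrite sv; lia.
  + exact: dyck_word_peaks.
Qed.

(* Both paths insert a peak into the same Dyck word, just before or just after
   the step with index i. *)
Lemma tunneling_switch n (i i1 i2 j : 'I_(2 * n)) :
  i1 = i.+1 :> nat -> i2 = i.+2 :> nat -> odd j = ~~ odd i -> j != i1 ->
  exists D1 D2 : (2 * n).-tuple bool,
    [/\ D1 \in dyck n, D2 \in dyck n,
        tunneling D1 i = i1 /\ tunneling D1 i2 = j,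
        tunneling D2 i1 = i2 /\ tunneling D2 i = j
      & forall x, x \notin [:: i; i1; i2; j] -> tunneling D1 x = tunneling D2 x].
Proof.
move=> e1 e2 oj; rewrite -val_eqE /= => nj.
have i2n := ltn_ord i2; have jn := ltn_ord j.
pose j0 := if j < i then (j : nat) else j - 2.
have [w [sw hw aw]] : exists w, [/\ size w = 2 * (n - 1), dyck_word w
    & arc w i j0 \/ arc w j0 i].
  rewrite /j0; case: ltnP => ji.
    have [||w [? ? ?]] := @dyck_word_with_arc (n - 1) j i; try lia.
    by exists w; split=> //; right.
  have [||w [? ? ?]] := @dyck_word_with_arc (n - 1) i (j - 2); try lia.
  by exists w; split=> //; left.
have ins k : k <= 2 * (n - 1) -> exists2 D : (2 * n).-tuple bool, D \in dyck n
    & D = take k w ++ [:: true, false & drop k w] :> seq bool.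
  move=> kn; apply: dyck_tuple.
    by rewrite size_cat /= size_takel ?size_drop sw; lia.
  by rewrite (@dyck_word_insert _ [:: true; false]) ?cat_take_drop.
have [|D1 D1n eD1] := ins i; first by lia.
have [|D2 D2n eD2] := ins i.+1; first by lia.
have s1 : size (take i w) = i by rewrite size_takel // sw; lia.
have s2 : size (take i.+1 w) = i.+1 by rewrite size_takel // sw; lia.
have t1 k l (x y : 'I_(2 * n)) : arc w k l \/ arc w l k ->
    x = skip i k :> nat -> y = skip i l :> nat -> tunneling D1 x = y.
  by move=> h ex ey; apply: (tunneling_insert eD1 (k := k) (l := l)); rewrite ?cat_take_drop ?s1.
have t2 k l (x y : 'I_(2 * n)) : arc w k l \/ arc w l k ->
    x = skip i.+1 k :> nat -> y = skip i.+1 l :> nat -> tunneling D2 x = y.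
  by move=> h ex ey; apply: (tunneling_insert eD2 (k := k) (l := l)); rewrite ?cat_take_drop ?s2.
have t1i2 : tunneling D1 i2 = j.
  by apply: (t1 _ _ _ _ aw); rewrite /skip /j0; repeat case: ifP; lia.
exists D1, D2; split=> //.
- by split=> //; apply: (tunneling_inserted eD1); rewrite s1.
- split; first by apply: (tunneling_inserted eD2); rewrite s2.
  by apply: (t2 _ _ _ _ aw); rewrite /skip /j0; repeat case: ifP; lia.
move=> x; rewrite !inE !negb_or -!val_eqE /= => /and4P[xi xi1 xi2 xj].
have xn := ltn_ord x.
pose y := if x < i then (x : nat) else x - 2.
have yw : y < size w by rewrite sw /y; case: ifP; lia.
have [z hz] := @matching_exists _ (in_tuple w) (Ordinal yw) hw.
have {hz} az : arc w y z \/ arc w z y.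
  by case/orP: hz => /matching_arc; [left | right].
have zn : z < 2 * (n - 1) by rewrite -sw.
(* The cuts at [i] and at [i.+1] shift every step of [w] alike except step [i], and a partner equal
   to [i] would force [x = j]. *)
have zi : (z : nat) <> i.
  move=> ez; have : tunneling D1 x = i2.
    by apply: (t1 _ _ _ _ az); rewrite /skip /y ?ez; repeat case: ifP; lia.
  move/(congr1 (tunneling D1)); rewrite tunnelingK t1i2 => exj.
  by rewrite exj eqxx in xj.
have z'n : skip i z < 2 * n by rewrite /skip; case: ifP; lia.
rewrite (t1 y z x (Ordinal z'n) az) ?(t2 y z x (Ordinal z'n) az) //=;
  rewrite /skip /y; repeat case: ifP; lia.
Qed.

(** * Arc counts, and how they determine a set up to complement *)

Section ArcWeight.
Import GRing.Theory.
Local Open Scope ring_scope.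

(** Every arc is counted from both of its ends: on Dyck paths, the indicator function of a set gives
    twice the number of arcs inside it. *)
Definition arc_weight m (f : 'I_m -> int) (D : m.-tuple bool) : int :=
  \sum_x f x * f (tunneling D x).

(** The two paths of [tunneling_switch] differ only in the arcs at [i], [i1], [i2], [j]. The
    difference of weights, twice [f i * f i1 + f i2 * f j - f i1 * f i2 - f i * f j], factors into
    the product shown. *)
Lemma arc_weight_switch n (f g : 'I_(2 * n) -> int) (i i1 i2 j : 'I_(2 * n)) :
  {in dyck n, arc_weight f =1 arc_weight g} ->
  i1 = i.+1 :> nat -> i2 = i.+2 :> nat -> odd j = ~~ odd i ->
  (f i - f i2) * (f i1 - f j) = (g i - g i2) * (g i1 - g j).
Proof.
move=> fg e1 e2 oj; have [->|nj] := eqVneq j i1; first by rewrite !subrr !mulr0.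
have [D1 [D2 [D1n D2n [t1 t1'] [t2 t2'] t12]]] := tunneling_switch e1 e2 oj nj.
have n1 : i1 != i by rewrite -val_eqE /= e1; lia.
have n2 : i2 != i by rewrite -val_eqE /= e2; lia.
have n21 : i2 != i1 by rewrite -val_eqE /= e1 e2; lia.
have nji : j != i by apply/eqP => e; move: oj; rewrite e; case: odd.
have nji2 : j != i2 by apply/eqP => e; move: oj; rewrite e e2 /= negbK; case: odd.
have sw h : arc_weight h D1 - arc_weight h D2 = 2 * ((h i - h i2) * (h i1 - h j)).
  rewrite /arc_weight.
  (* The four affected positions are split off from each sum; the remainders [S1] and [S2]
     coincide. *)
  rewrite (bigD1 i) // (bigD1 i1) //= (bigD1 i2) ?n2 //= (bigD1 j) /= ?nji ?nj //.
  rewrite [X in _ - X](bigD1 i) // [X in _ - (_ + X)](bigD1 i1) //=.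
  rewrite [X in _ - (_ + (_ + X))](bigD1 i2) ?n2 //=.
  rewrite [X in _ - (_ + (_ + (_ + X)))](bigD1 j) /= ?nji ?nj //.
  have t1K : tunneling D1 i1 = i by rewrite -t1 tunnelingK.
  have t1K' : tunneling D1 j = i2 by rewrite -t1' tunnelingK.
  have t2K : tunneling D2 i2 = i1 by rewrite -t2 tunnelingK.
  have t2K' : tunneling D2 j = i by rewrite -t2' tunnelingK.
  rewrite t1 t1' t1K t1K' t2 t2' t2K t2K'.
  set S1 := (X in _ + (_ + (_ + (_ + X))) - _).
  set S2 := (X in _ - (_ + (_ + (_ + (_ + X))))).
  have -> : S1 = S2.
    apply: eq_bigr => x; rewrite -!andbA => /and4P[x0 x1 x2 x3].
    by rewrite t12 // !inE !negb_or x0 x1 x2 x3.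
  by ring.
by have := sw f; rewrite !fg // sw; lia.
Qed.

(* Telescoping the switch identity along i, i + 2, i + 4, ... *)
Lemma arc_weight_rectangle n (f g : 'I_(2 * n) -> int) (i i' j j' : 'I_(2 * n)) :
  {in dyck n, arc_weight f =1 arc_weight g} ->
  odd i' = odd i -> odd j = ~~ odd i -> odd j' = ~~ odd i ->
  (f i - f i') * (f j - f j') = (g i - g i') * (g j - g j').
Proof.
move=> fg oi oj oj'.
have step m (x y : 'I_(2 * n)) : y = (x + m.*2)%N :> nat -> odd x = odd i ->
    (f x - f y) * (f j - f j') = (g x - g y) * (g j - g j').
  elim: m y => [|m IHm] y ey ox.
    have -> : y = x by apply: val_inj; rewrite /= ey addn0.
    by rewrite !subrr !mul0r.
  have yn := ltn_ord y.
  have zn : (x + m.*2 < 2 * n)%N by lia.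
  have z1n : (x + m.*2.+1 < 2 * n)%N by lia.
  have e1 : Ordinal z1n = (Ordinal zn).+1 :> nat by rewrite /= addnS.
  have e2 : y = (Ordinal zn).+2 :> nat by rewrite ey /=; lia.
  have oz : odd (Ordinal zn) = odd i by rewrite /= oddD odd_double addbF.
  have s := arc_weight_switch fg e1 e2.
  have := s j; have := s j'; rewrite oz => /(_ oj') s1 /(_ oj) s2.
  have s3 := IHm (Ordinal zn) erefl ox.
  set z := Ordinal zn in s1 s2 s3; set w := Ordinal z1n in s1 s2.
  (* Here [w] lies between [z] and [y]. Subtracting the switch at [z] with [j] from the one with
     [j'] cancels [h w] and leaves the rectangle on [z], [y]. *)
  have r (h : 'I_(2 * n) -> int) : (h x - h y) * (h j - h j') =
      (h x - h z) * (h j - h j') +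
      ((h z - h y) * (h w - h j') - (h z - h y) * (h w - h j)) by ring.
  by rewrite !r s1 s2 s3.
have [le|/ltnW le] := leqP i i'.
  by apply: (step (i' - i)./2) => //; lia.
have s := step (i - i')./2 i' i _ oi.
by rewrite -[f i - _]opprB -[g i - _]opprB !mulNr s //; lia.
Qed.

Definition arcs_inside m (A : {set 'I_m}) : m.-tuple bool -> int :=
  arc_weight (fun x => (x \in A)%:R).

(** The rectangle on [x0], [y0], [x1], [y1] has value 1 for [A]. For [B] both factors are then 1 or
    both are -1, so on these points [B] equals [A] or its complement. Rectangles with any [z] in
    place of [x0] or [x1], according to its parity, carry this choice to all points. *)
Lemma arcs_inside_split n (A B : {set 'I_(2 * n)}) (x0 x1 y0 y1 : 'I_(2 * n)) :
  {in dyck n, arcs_inside A =1 arcs_inside B} ->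
  x0 \in A -> x1 \in A -> y0 \notin A -> y1 \notin A ->
  odd x0 != odd x1 -> odd y0 != odd y1 -> A = B \/ A = ~: B.
Proof.
wlog oy : y0 y1 / odd y0 = odd x0.
  move=> wl AB Ax0 Ax1 Ay0 Ay1 ox oy; case: (eqVneq (odd y0) (odd x0)) => e.
    exact: (wl y0 y1).
  apply: (wl y1 y0) => //; last by rewrite eq_sym.
  by case: (odd y1) (odd y0) (odd x0) oy e => [] [] [].
move=> AB Ax0 Ax1 /negbTE Ay0 /negbTE Ay1 ox oy'.
have ox1 : odd x1 = ~~ odd x0 by case: (odd x1) (odd x0) ox => [] [].
have oy1 : odd y1 = ~~ odd x0.
  by case: (odd y1) (odd y0) (odd x0) oy oy' => [] [] [].
have rect i i' j j' := @arc_weight_rectangle n _ _ i i' j j' AB.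
have := rect x0 y0 x1 y1 oy ox1 oy1; rewrite Ax0 Ax1 Ay0 Ay1.
have same (z : 'I_(2 * n)) (oz : odd z = odd x0) := rect z y0 x1 y1
  (etrans oy (esym oz)) (etrans ox1 (congr1 negb (esym oz)))
  (etrans oy1 (congr1 negb (esym oz))).
have diff (z : 'I_(2 * n)) (oz : odd z = ~~ odd x0) := rect x0 y0 z y1 oy oz oy1.
have oddP (z : 'I_(2 * n)) : odd z = odd x0 \/ odd z = ~~ odd x0.
  by case: (odd z) (odd x0) => [] []; [left | right | right | left].
(* Of the sixteen membership patterns of [B] on the four points, only that of [A] and its opposite
   survive. *)
case B0: (x0 \in B); case B1: (x1 \in B); case C0: (y0 \in B);
  case C1: (y1 \in B) => //= _; [left | right]; apply/setP => z; rewrite ?inE;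
  case: (oddP z) => [/same | /diff];
  rewrite ?Ax0 ?Ax1 ?Ay0 ?Ay1 ?B0 ?B1 ?C0 ?C1; by case: (z \in A); case: (z \in B).
Qed.

Lemma sum_mem m (A : {set 'I_m}) : \sum_x (x \in A)%:R = #|A|%:R :> int.
Proof.
rewrite -sum1_card natr_sum (bigID [in A]) /= [X in _ + X]big1 ?addr0.
  by apply: eq_bigr => x ->.
by move=> x /negbTE ->.
Qed.

(** Expand [(1 - f x) * (1 - f (tunneling D x))] and sum. The constant vanishes when [A] has half of
    the points, which is why complements matter at [k = n]. *)
Lemma arcs_insideC m (A : {set 'I_m}) (D : m.-tuple bool) :
  arcs_inside (~: A) D = m%:R - 2 * #|A|%:R + arcs_inside A D.
Proof.
rewrite /arcs_inside /arc_weight.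
pose f x : int := (x \in A)%:R.
have fC x : (x \in ~: A)%:R = 1 - f x :> int by rewrite inE /f; case: (x \in A).
under eq_bigr => x _ do rewrite !fC.
have -> : \sum_x (1 - f x) * (1 - f (tunneling D x)) =
    \sum_(x : 'I_m) 1 - \sum_x f x - \sum_x f (tunneling D x)
    + \sum_x f x * f (tunneling D x).
  rewrite -!sumrB -big_split /=; apply: eq_bigr => x _; by ring.
have <- : \sum_x f x = \sum_x f (tunneling D x) by apply: (reindex_inj perm_inj).
rewrite sum_mem sumr_const cardT size_enum_ord -/f; by ring.
Qed.

Lemma arcs_inside_mono m (A : {set 'I_m}) (D : m.-tuple bool) c : dyck_word D ->
  {in A, forall x : 'I_m, odd x = c} -> arcs_inside A D = 0.
Proof.
move=> hD Ac; apply: big1 => x _.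
case Ax: (x \in A); last by rewrite mul0r.
case At: (tunneling D x \in A); last by rewrite mulr0.
by have := odd_tunneling x hD; rewrite (Ac _ Ax) (Ac _ At); case: c {Ac}.
Qed.

Lemma mem_initial_set m (s : 'S_m) k x : (x \in initial_set s k) = ((s^-1)%g x < k)%N.
Proof.
apply/imsetP/idP => [[i]|lt_k]; first by rewrite inE => ik ->; rewrite permK.
by exists ((s^-1)%g x); rewrite ?inE // permKV.
Qed.

(** Adding the value [s k] completes an arc exactly when its partner is already present, that is,
    when step [k] is a down-step; the factor 2 counts both ends. *)
Lemma arcs_inside_initial m (s : 'S_m) (D : m.-tuple bool) (k : 'I_m) :
  dyck_word D ->
  arcs_inside (initial_set s k.+1) D =
  arcs_inside (initial_set s k) D + 2 * (~~ tnth (sigma_path s D) k)%:R.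
Proof.
move=> hD; rewrite tnth_mktuple.
set y := s k; have ny := tunneling_neq y hD; set y' := tunneling D y in ny *.
have memS x : (x \in initial_set s k.+1) = (x == y) || (x \in initial_set s k).
  rewrite !mem_initial_set ltnS leq_eqVlt; congr orb.
  apply/eqP/eqP => [e|->]; last by rewrite permK.
  by rewrite /y -(permKV s x); congr (s _); apply: val_inj.
have yk : (y \in initial_set s k) = false by rewrite mem_initial_set permK ltnn.
have ty' : tunneling D y' = y by rewrite tunnelingK.
rewrite /arcs_inside /arc_weight (bigD1 y) // (bigD1 y') //=.
rewrite [X in _ = X + _](bigD1 y) // [X in _ = _ + X + _](bigD1 y') //=.
rewrite ty' -/y' !memS eqxx yk (negbTE ny) /=.
set S1 := (X in _ + (_ + X) = _); set S2 := (X in _ = _ + (_ + X) + _).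
have -> : S1 = S2.
  apply: eq_bigr => x /andP[xy xy'].
  rewrite !memS (negbTE xy) /= (_ : (tunneling D x == y) = false) //.
  by apply: contraNF xy' => /eqP e; rewrite /y' -e tunnelingK.
by case: (y' \in initial_set s k) => /=; ring.
Qed.

Lemma initial_set0 m (s : 'S_m) : initial_set s 0 = set0.
Proof. by apply/setP => x; rewrite mem_initial_set inE. Qed.

(** The counts are twice the partial sums of the down-steps, so they determine the path step by step
    and conversely. *)
Lemma path_equivP n (s t : 'S_(2 * n)) :
  path_equiv s t <->
  forall k, (k <= 2 * n)%N ->
    {in dyck n, arcs_inside (initial_set s k) =1 arcs_inside (initial_set t k)}.
Proof.
split=> [/forallP st k|st].
  move=> kn D Dn; have hD := dyck_dyck_word Dn.
  have := st D; rewrite Dn => /eqP eD.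
  elim: k kn => [|k IHk] kn; first by rewrite !initial_set0.
  have := arcs_inside_initial s (Ordinal kn) hD.
  have := arcs_inside_initial t (Ordinal kn) hD => /= -> ->.
  by rewrite eD IHk // ltnW.
apply/forallP => D; apply/implyP => Dn; have hD := dyck_dyck_word Dn.
apply/eqP/eq_from_tnth => k.
have := arcs_inside_initial s k hD; rewrite !st // 1?ltnW //.
rewrite (arcs_inside_initial t k hD) => /addrI.
by case: (tnth _ _); case: (tnth _ _).
Qed.

End ArcWeight.

(** * The parities [a], [b] of a permutation, and bounds on them *)

Local Arguments entry : simpl never.
Local Arguments par_left : simpl never.
Local Arguments par_right : simpl never.

Lemma find_iota1_eq (P : pred nat) m k : 0 < k < m -> P k ->
  (forall c, 0 < c < k -> ~~ P c) -> (find P (iota 1 m.-1)).+1 = k.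
Proof.
move=> km Pk minP; have /= := find_iota1P km Pk.
move: (find _ _) => a [am Pa mina]; apply/eqP; rewrite eqn_leq; apply/andP; split.
  by rewrite leqNgt; apply/negP => ka; have := mina k; rewrite Pk; lia.
by rewrite leqNgt; apply/negP => ak; have := minP a.+1; rewrite Pa; lia.
Qed.

Lemma entry_parity m (s : 'S_m) (i j : 'I_m) :
  (entry s i.+1 == entry s j.+1 %[mod 2]) = (odd (s i) == odd (s j)).
Proof. by rewrite !entryE !modn2 /=; case: (odd (s i)); case: (odd (s j)). Qed.

(** Positions are 0-based, so index [a] holds the first entry of the other parity. The xor puts the
    constant run and its break into one rewritable equation; [par_rightE] is the mirror image. *)
Lemma par_leftE n (s : 'S_(2 * n)) a : 0 < n ->
  par_left s = a <->
  0 < a < 2 * n /\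
  exists c, forall i : 'I_(2 * n), i <= a -> odd (s i) = c (+) (i == a :> nat).
Proof.
move=> n0; split=> [<- {a}|[an [c sc]]].
  have := par_leftP s n0; move: (par_left s) => a [an nea eqa]; split=> //.
  have i0n : 0 < 2 * n by lia.
  have ltc k : k < a -> forall i : 'I_(2 * n), i = k :> nat ->
      odd (s i) = odd (s (Ordinal i0n)).
    elim: k => [|k IHk] ka i ei; first by congr (odd (s _)); apply: val_inj.
    have kn : k < 2 * n by lia.
    rewrite -(IHk _ (Ordinal kn)) //; last by lia.
    have := eqa k.+1 ka; have := entry_parity s (Ordinal kn) i.
    by rewrite /= ei => + e; rewrite e eqxx => /esym/eqP.
  exists (odd (s (Ordinal i0n))) => i; rewrite leq_eqVlt => /orP[/eqP ei|ia].
    have a1n : a.-1 < 2 * n by lia.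
    have := entry_parity s (Ordinal a1n) i; rewrite /= ei prednK; last by lia.
    rewrite (negbTE nea) eqxx => /esym; rewrite (ltc a.-1 _ (Ordinal a1n)) //; last by lia.
    by case: (odd (s i)); case: (odd (s _)).
  by rewrite (ltc i) // ltn_eqF // addbF.
apply: find_iota1_eq => //.
  have a1n : a.-1 < 2 * n by lia.
  have aan : a < 2 * n by lia.
  have := entry_parity s (Ordinal a1n) (Ordinal aan); rewrite /= prednK; last by lia.
  by move=> ->; rewrite !sc /=; lia.
move=> k ka; rewrite negbK.
have k1n : k.-1 < 2 * n by lia.
have kn : k < 2 * n by lia.
have := entry_parity s (Ordinal k1n) (Ordinal kn); rewrite /= prednK; last by lia.
by move=> ->; rewrite !sc /=; lia.
Qed.

Lemma par_rightE n (s : 'S_(2 * n)) b : 0 < n ->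
  par_right s = b <->
  0 < b < 2 * n /\
  exists c, forall i : 'I_(2 * n), 2 * n - b <= i.+1 ->
    odd (s i) = c (+) (i.+1 == 2 * n - b).
Proof.
move=> n0; split=> [<- {b}|[bn [c sc]]].
  have := par_rightP s n0; move: (par_right s) => b [bn neb eqb]; split=> //.
  have i0n : (2 * n).-1 < 2 * n by lia.
  have ltc k : k < b -> forall i : 'I_(2 * n), i + k = (2 * n).-1 ->
      odd (s i) = odd (s (Ordinal i0n)).
    elim: k => [|k IHk] kb i ei; first by congr (odd (s _)); apply: val_inj => /=; lia.
    have in_ : i.+1 < 2 * n by lia.
    rewrite -(IHk _ (Ordinal in_)) //=; try lia.
    have := eqb k.+1 kb; have := entry_parity s (Ordinal in_) i.
    have -> : 2 * n + 1 - k.+1 = i.+2 by lia.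
    have -> : 2 * n - k.+1 = i.+1 by lia.
    by move=> /= + e; rewrite e eqxx => /esym/eqP.
  exists (odd (s (Ordinal i0n))) => i; rewrite leq_eqVlt => /orP[/eqP ei|ib].
    have in_ : i.+1 < 2 * n by lia.
    have := entry_parity s (Ordinal in_) i; move: neb; rewrite /= ei eqxx.
    have -> : 2 * n + 1 - b = i.+2 by lia.
    move=> /negbTE -> /esym; rewrite (ltc b.-1 _ (Ordinal in_)) //=; lia.
  have in_ := ltn_ord i.
  by rewrite (ltc ((2 * n).-1 - i)) ?gtn_eqF ?addbF //; lia.
apply: find_iota1_eq => //.
  have b1n : 2 * n - b < 2 * n by lia.
  have bbn : (2 * n - b).-1 < 2 * n by lia.
  have := entry_parity s (Ordinal b1n) (Ordinal bbn); rewrite /= prednK; last by lia.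
  have -> : 2 * n + 1 - b = (2 * n - b).+1 by lia.
  by move=> ->; rewrite !sc /=; lia.
move=> k kb; rewrite negbK.
have k1n : 2 * n - k < 2 * n by lia.
have kn : (2 * n - k).-1 < 2 * n by lia.
have := entry_parity s (Ordinal k1n) (Ordinal kn); rewrite /= prednK; last by lia.
have -> : 2 * n + 1 - k = (2 * n - k).+1 by lia.
by move=> ->; rewrite !sc /=; lia.
Qed.

Lemma card_ord_lt m k : k <= m -> #|[set i : 'I_m | i < k]| = k.
Proof.
move=> km; rewrite -sum1dep_card (big_ord_narrow km) /=.
by rewrite sum_nat_const card_ord muln1.
Qed.

Lemma card_initial_set m (s : 'S_m) k : k <= m -> #|initial_set s k| = k.
Proof. by move=> km; rewrite card_imset ?card_ord_lt //; apply: perm_inj. Qed.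

Lemma card_same_parity n (s : 'S_(2 * n)) (P : {set 'I_(2 * n)}) c :
  {in P, forall i, odd (s i) = c} -> #|P| <= n.
Proof.
move=> Pc; rewrite -(card_imset P (@perm_inj _ s)).
(* The values of parity [c] are the numbers [2 * i + c] with [i < n]. *)
have lt (i : 'I_n) : 2 * i + c < 2 * n by have := ltn_ord i; case: (c) => /=; lia.
have := leq_imset_card (fun i => Ordinal (lt i)) predT; rewrite cardT size_enum_ord.
apply: leq_trans; apply/subset_leq_card/subsetP => _ /imsetP[i /Pc ic ->].
have hn : (s i)./2 < n by have := ltn_ord (s i); lia.
apply/imsetP; exists (Ordinal hn) => //; apply: val_inj => /=.
by rewrite -ic; lia.
Qed.

(** If [a >= n], the first [n] entries exhaust one parity. But the entries at [2 * n - b] and just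
    before it have different parities and, since [b < n], lie beyond the first [n]: one value too
    many. *)
Lemma par_left_lt n (s : 'S_(2 * n)) a b :
  0 < n -> par s = (a, b) -> b < n -> a < n.
Proof.
move=> n0 [sa sb] bn; rewrite ltnNge; apply/negP => an.
have [a0 [c lc]] := (par_leftE s a n0).1 sa.
have [b0 [d rd]] := (par_rightE s b n0).1 sb.
have [i ni ic] : exists2 i : 'I_(2 * n), n <= i & odd (s i) = c.
  have pn : (2 * n - b).-1 < 2 * n by lia.
  have qn : 2 * n - b < 2 * n by lia.
  have := rd (Ordinal pn); have := rd (Ordinal qn).
  rewrite /= prednK; last by lia.
  rewrite leqnn leqnSn eqxx gtn_eqF ?leqnn // => /(_ isT) eq /(_ isT) ep.
  case: (eqVneq c d) => [cd|cd].
    by exists (Ordinal qn); rewrite /= ?cd ?eq ?addbF //; lia.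
  exists (Ordinal pn); rewrite /= ?ep //; first by lia.
  by case: c d cd {lc rd eq ep} => [] [].
have : #|i |: [set j : 'I_(2 * n) | j < n]| <= n.
  apply: (@card_same_parity n s _ c) => j; rewrite !inE => /orP[/eqP->//|jn].
  by rewrite lc; lia.
by rewrite cardsU1 inE ltnNge ni card_ord_lt; lia.
Qed.

Lemma par_right_lt n (s : 'S_(2 * n)) a b :
  0 < n -> par s = (a, b) -> a < n -> b < n.
Proof.
move=> n0 [sa sb] an; rewrite ltnNge; apply/negP => bn.
have [a0 [c lc]] := (par_leftE s a n0).1 sa.
have [b0 [d rd]] := (par_rightE s b n0).1 sb.
have [i ni ic] : exists2 i : 'I_(2 * n), i < n & odd (s i) = d.
  have pn : a.-1 < 2 * n by lia.
  have qn : a < 2 * n by lia.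
  have := lc (Ordinal pn); have := lc (Ordinal qn).
  rewrite /= leqnn leq_pred eqxx ltn_eqF; last by lia.
  move=> /(_ isT) eq /(_ isT) ep.
  case: (eqVneq c d) => [cd|cd].
    by exists (Ordinal pn); rewrite /= ?ep ?cd ?addbF //; lia.
  exists (Ordinal qn); rewrite /= ?eq //.
  by case: c d cd {lc rd eq ep} => [] [].
have : #|i |: ~: [set j : 'I_(2 * n) | j < n]| <= n.
  apply: (@card_same_parity n s _ d) => j; rewrite !inE => /orP[/eqP->//|jn].
  by rewrite rd; lia.
by rewrite cardsU1 !inE ni [#|~: _|]cardsCs setCK card_ord card_ord_lt; lia.
Qed.

(** * Path equivalence in terms of initial sets *)

Lemma path_class_eq n (s t : 'S_(2 * n)) :
  path_class s = path_class t <-> path_equiv s t.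
Proof.
split=> [e|/forallP st].
  have : t \in path_class t by rewrite inE; apply/forallP => D; apply/implyP.
  by rewrite -e inE.
apply/setP => x; rewrite !inE; apply: eq_forallb => D.
by have := st D; case: (D \in dyck n) => //= /eqP ->.
Qed.

Lemma path_equiv_initial n (s t : 'S_(2 * n)) a b :
  0 < n -> par s = (a, b) -> par t = (a, b) ->
  path_equiv s t <->
  forall k, a < k < 2 * n - b -> initial_set s k = initial_set t k \/
    k = n /\ initial_set s k = ~: initial_set t k.
Proof.
move=> n0 [sa sb] [ta tb].
have [an [c sc]] := (par_leftE s a n0).1 sa.
have [bn [d sd]] := (par_rightE s b n0).1 sb.
have [_ [c' tc]] := (par_leftE t a n0).1 ta.
have [_ [d' td]] := (par_rightE t b n0).1 tb.
rewrite path_equivP; split=> [st k kab|st k kn D Dn].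
  have kn : k <= 2 * n by lia.
  have a1n : a.-1 < 2 * n by lia.
  have aan : a < 2 * n by lia.
  have b1n : 2 * n - b < 2 * n by lia.
  have bbn : (2 * n - b).-1 < 2 * n by lia.
  (* The parity changes at the two ends supply the points: the left one lies inside both of its
     entries since [a < k], the right one outside since [k < 2 * n - b]. *)
  have [] := @arcs_inside_split n _ _ (s (Ordinal a1n)) (s (Ordinal aan))
    (s (Ordinal b1n)) (s (Ordinal bbn)) (st k kn).
  - by rewrite mem_initial_set permK /=; lia.
  - by rewrite mem_initial_set permK /=; lia.
  - by rewrite mem_initial_set permK /=; lia.
  - by rewrite mem_initial_set permK /=; lia.
  - by rewrite !sc /=; lia.
  - by rewrite !sd /=; lia.
  - by left.
  (* A set of [k] elements whose complement has [k] elements forces [k = n]. *)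
  move=> e; right; split=> //.
  have := congr1 (fun A : {set _} => #|A|) e.
  by rewrite /= [RHS]cardsCs setCK !card_initial_set // card_ord; lia.
have hD := dyck_dyck_word Dn.
have [ka|ak] := leqP k a.
  rewrite (@arcs_inside_mono _ _ _ c) ?(@arcs_inside_mono _ _ _ c') // => x;
    rewrite mem_initial_set => xk.
    by rewrite -(permKV t x) tc ?ltn_eqF ?addbF //; lia.
  by rewrite -(permKV s x) sc ?ltn_eqF ?addbF //; lia.
have [kb|bk] := ltnP k (2 * n - b).
  have [|->//|[ek ->]] := st k; first by lia.
  by rewrite arcs_insideC card_initial_set // ek; lia.
(* For [k >= 2 * n - b] the complements have a single parity and contain no arcs, so both counts
   equal the same constant. *)
have := arcs_insideC (initial_set s k) D; have := arcs_insideC (initial_set t k) D.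
rewrite !card_initial_set //.
rewrite (@arcs_inside_mono _ (~: initial_set t k) _ d') //.
  rewrite (@arcs_inside_mono _ (~: initial_set s k) _ d) //; first by lia.
  move=> x; rewrite inE mem_initial_set => xk.
  by rewrite -(permKV s x) sd ?gtn_eqF ?addbF //; lia.
move=> x; rewrite inE mem_initial_set => xk.
by rewrite -(permKV t x) td ?gtn_eqF ?addbF //; lia.
Qed.

(** * Initial sets, entries, friends and families *)

Lemma initial_setS m (s : 'S_m) (i : 'I_m) :
  initial_set s i.+1 = s i |: initial_set s i.
Proof.
apply/setP => x; rewrite in_setU1 !mem_initial_set ltnS leq_eqVlt; congr orb.
by apply/eqP/eqP => [/val_inj <-|->]; rewrite ?permKV ?permK.
Qed.

Lemma initial_set_notin m (s : 'S_m) (i : 'I_m) : s i \notin initial_set s i.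
Proof. by rewrite mem_initial_set permK ltnn. Qed.

Lemma initial_setT m (s : 'S_m) k : m <= k -> initial_set s k = setT.
Proof.
by move=> mk; apply/setP => x; rewrite mem_initial_set inE; apply: leq_trans mk.
Qed.

Lemma initial_set_entry m (s t : 'S_m) (i : 'I_m) :
  initial_set s i = initial_set t i -> initial_set s i.+1 = initial_set t i.+1 ->
  s i = t i.
Proof.
rewrite !initial_setS => e e1; apply/eqP.
have : s i \in t i |: initial_set t i by rewrite -e1 setU11.
by rewrite in_setU1 -e (negbTE (initial_set_notin s i)) orbF.
Qed.

Lemma initial_set_pred m (s t : 'S_m) (i : 'I_m) :
  s i = t i -> initial_set s i.+1 = initial_set t i.+1 ->
  initial_set s i = initial_set t i.
Proof.
rewrite !initial_setS => e e1.
by rewrite -(setU1K (initial_set_notin s i)) -(setU1K (initial_set_notin t i)) e1 e.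
Qed.

(** The entry at index [i] is what distinguishes two successive initial sets. This turns friendship
    and families into equalities over a range of [k], directly comparable with path equivalence. *)
Lemma initial_set_chain m (s t : 'S_m) k l : k <= l <= m ->
  (initial_set s k = initial_set t k /\
   forall i : 'I_m, k <= i < l -> s i = t i) <->
  (forall j, k <= j <= l -> initial_set s j = initial_set t j).
Proof.
move=> klm; split=> [[ek st] j|st].
  elim: j => [|j IHj] jkl; first by rewrite !initial_set0.
  have [e|nk] := eqVneq k j.+1; first by rewrite -e.
  have jm : j < m by lia.
  have := initial_setS s (Ordinal jm); have := initial_setS t (Ordinal jm).
  by rewrite /= => -> ->; rewrite IHj ?st //=; lia.
split=> [|i ikl]; first by apply: st; lia.
by apply: initial_set_entry; apply: st; lia.
Qed.

(* The entry at p is recognised as the only one of its parity; the positions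
   i0 and i1 are needed to know which parity is the exceptional one. *)
Lemma odd_one_out m (P : pred nat) (s t : 'S_m) (p i0 i1 : 'I_m) c d :
  P p -> P i0 -> P i1 -> i0 != p -> i1 != p -> i0 != i1 ->
  (forall i : 'I_m, P i -> odd (s i) = c (+) (i == p)) ->
  (forall i : 'I_m, P i -> odd (t i) = d (+) (i == p)) ->
  (forall i : 'I_m, P i -> P ((t^-1)%g (s i))) -> s p = t p.
Proof.
move=> Pp P0 P1 n0 n1 n01 sc td st.
have tst i : t ((t^-1)%g (s i)) = s i by rewrite permKV.
have [cd|cd] := eqVneq c d.
  have := td _ (st _ Pp); rewrite tst sc // eqxx cd.
  by case: eqP => [e _|_]; [rewrite -(tst p) e | case: (d)].
(* If [c] and [d] differ, every other [i] in [P] would have [s i = t p]; the two positions [i0] and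
   [i1] refute this. *)
have at_p (i : 'I_m) : P i -> i != p -> s i = t p.
  move=> Pi ni; have := td _ (st _ Pi); rewrite tst sc // (negbTE ni) addbF.
  by case: eqP => [e _|_]; [rewrite -(tst i) e | rewrite addbF => e; rewrite e eqxx in cd].
by have := at_p _ P0 n0; rewrite -(at_p _ P1 n1) => /perm_inj e; rewrite e eqxx in n01.
Qed.

(** Among the first [a.+1] entries the one at index [a] is alone in its parity, and [1 < a] makes it
    recognisable, so [s] and [t] agree there and it can be removed. This reaches the endpoint
    [k = a] that friendship requires. *)
Lemma initial_set_par_left n (s t : 'S_(2 * n)) a :
  0 < n -> par_left s = a -> par_left t = a -> 1 < a ->
  initial_set s a.+1 = initial_set t a.+1 -> initial_set s a = initial_set t a.
Proof.
move=> n0 /(par_leftE _ _ n0)[an [c sc]] /(par_leftE _ _ n0)[_ [d td]] a1 e.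
have pn : a < 2 * n by lia.
have i0n : 0 < 2 * n by lia.
have i1n : 1 < 2 * n by lia.
apply: (@initial_set_pred _ s t (Ordinal pn)) => //.
apply: (@odd_one_out _ (fun i => i < a.+1) _ _ _ (Ordinal i0n) (Ordinal i1n) c d);
  rewrite -?val_eqE /= //; try lia.
by move=> i ia; rewrite -mem_initial_set -e mem_initial_set permK.
Qed.

Lemma initial_set_par_right n (s t : 'S_(2 * n)) b :
  0 < n -> par_right s = b -> par_right t = b -> 1 < b ->
  initial_set s (2 * n - b).-1 = initial_set t (2 * n - b).-1 ->
  initial_set s (2 * n - b) = initial_set t (2 * n - b).
Proof.
move=> n0 /(par_rightE _ _ n0)[bn [c sc]] /(par_rightE _ _ n0)[_ [d td]] b1 e.
have pn : (2 * n - b).-1 < 2 * n by lia.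
have i0n : 2 * n - b < 2 * n by lia.
have i1n : (2 * n - b).+1 < 2 * n by lia.
have st : s (Ordinal pn) = t (Ordinal pn).
  apply: (@odd_one_out _ (fun i => 2 * n - b <= i.+1) _ _ _ (Ordinal i0n) (Ordinal i1n) c d);
    rewrite -?val_eqE /=; try lia.
  - by move=> i ib; rewrite sc // -val_eqE /=; congr addb; lia.
  - by move=> i ib; rewrite td // -val_eqE /=; congr addb; lia.
  move=> i ib; rewrite leqNgt; apply/negP => lt.
  have : s i \in initial_set t (2 * n - b).-1 by rewrite mem_initial_set; lia.
  by rewrite -e mem_initial_set permK; lia.
have := initial_setS s (Ordinal pn); have := initial_setS t (Ordinal pn).
by rewrite /= prednK; [move=> -> ->; rewrite e st | lia].
Qed.

(** Complementary sets at [k = n] are excluded by a neighbouring [k] in the range: at [n - 1] a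
    common nonempty subset contradicts disjointness, at [n + 1] a common proper superset contradicts
    covering. *)
Lemma path_equiv_initial_eq n (s t : 'S_(2 * n)) a b :
  3 <= n -> par s = (a, b) -> par t = (a, b) ->
  a < n -> b < n -> (a, b) <> (n - 1, n - 1) ->
  path_equiv s t <->
  forall k, a < k < 2 * n - b -> initial_set s k = initial_set t k.
Proof.
move=> n3 sab tab an bn nab; have n0 : 0 < n by lia.
rewrite (path_equiv_initial n0 sab tab); split=> st k kab; last by left; apply: st.
have [//|[ek eC]] := st k kab; subst k; exfalso.
have mon (r : 'S_(2 * n)) k l : k <= l -> initial_set r k \subset initial_set r l.
  by move=> kl; apply/subsetP => x; rewrite !mem_initial_set => /leq_trans; apply.
have [a1|a1] := ltnP a n.-1.
  have [|e|[]] := st n.-1; [by lia | | by lia].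
  have : initial_set s n.-1 \subset initial_set s n :&: initial_set t n.
    by rewrite subsetI {2}e !mon ?leq_pred.
  rewrite eC setIC setICr => /subset_leq_card.
  by rewrite cards0 card_initial_set; lia.
have [|e|[]] := st n.+1; [ | | by lia].
  suff : b <> n - 1 by lia.
  by move=> eb; apply: nab; congr pair; lia.
have : initial_set s n :|: initial_set t n \subset initial_set s n.+1.
  by rewrite subUset {2}e !mon.
rewrite eC setUC setUCr => /subset_leq_card.
by rewrite cardsT card_ord card_initial_set; lia.
Qed.

Lemma friendsE n (s t : 'S_(2 * n)) a b :
  par s = (a, b) -> a <= 2 * n - b ->
  friends s t <->
  par t = (a, b) /\
  (forall k, a <= k <= 2 * n - b -> initial_set s k = initial_set t k).
Proof.
move=> sab ab; rewrite -(@initial_set_chain _ s t); last by lia.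
rewrite /friends sab; split=> [[-> ea st]|[-> [ea st]]]; split=> //.
  by split=> // i i_ab; apply: st; lia.
by move=> i i_ab; apply: st; lia.
Qed.

Lemma famE n (s t : 'S_(2 * n)) : 2 <= n ->
  t \in fam s <->
  (forall k, 2 <= k <= 2 * n - 2 -> initial_set s k = initial_set t k).
Proof.
move=> n2; rewrite -(@initial_set_chain _ s t); last by lia.
rewrite inE; split=> [/andP[/eqP e /forallP st]|[-> st]].
  by split=> // i i2; apply/eqP; move/implyP: (st i); apply; lia.
rewrite eqxx; apply/forallP => i; apply/implyP => i3; apply/eqP; apply: st; lia.
Qed.

Lemma initial_set_tperm m (s : 'S_m) (p q : 'I_m) (k : nat) : q = p.+1 :> nat -> k <> q ->
  initial_set (tperm p q * s)%g k = initial_set s k.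
Proof.
move=> epq kq; apply/setP => x; rewrite !mem_initial_set invMg permM tpermV.
by case: tpermP => [->|->|//]; lia.
Qed.

(** The two sets leave the same pair of values for [p] and [q], placed in the same order or in the
    swapped one. *)
Lemma initial_set_tperm_or m (s t : 'S_m) (p q : 'I_m) : q = p.+1 :> nat ->
  initial_set s p = initial_set t p -> initial_set s q.+1 = initial_set t q.+1 ->
  initial_set s q = initial_set t q \/
  initial_set s q = initial_set (tperm p q * t)%g q.
Proof.
move=> epq e e2.
have : s p \in initial_set t q.+1 by rewrite -e2 mem_initial_set permK; lia.
rewrite initial_setS epq initial_setS !in_setU1 -e (negbTE (initial_set_notin _ _)).
rewrite orbF => /orP[] /eqP st; [right | left]; rewrite !initial_setS ?st ?e //.
by rewrite permM tpermL initial_set_tperm //; lia.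
Qed.

Lemma par_left_agree n (s t : 'S_(2 * n)) a : 0 < n -> par_left s = a ->
  (forall i : 'I_(2 * n), i <= a -> t i = s i) -> par_left t = a.
Proof.
move=> n0 /(par_leftE _ _ n0)[an [c sc]] ts; apply/(par_leftE _ _ n0).
by split=> //; exists c => i ia; rewrite ts ?sc.
Qed.

Lemma par_right_agree n (s t : 'S_(2 * n)) b : 0 < n -> par_right s = b ->
  (forall i : 'I_(2 * n), 2 * n - b <= i.+1 -> t i = s i) -> par_right t = b.
Proof.
move=> n0 /(par_rightE _ _ n0)[bn [c sc]] ts; apply/(par_rightE _ _ n0).
by split=> //; exists c => i ib; rewrite ts ?sc.
Qed.

Lemma par_left_tperm n (s : 'S_(2 * n)) (p q : 'I_(2 * n)) :
  0 < n -> p = 0 :> nat -> q = 1 :> nat ->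
  par_left s = 1 -> par_left (tperm p q * s)%g = 1.
Proof.
move=> n0 ep eq /(par_leftE _ _ n0)[an [c sc]]; apply/(par_leftE _ _ n0).
split=> //; exists (~~ c) => i i1; rewrite permM.
case: tpermP => [->|->|/eqP np /eqP nq]; first by rewrite sc; lia.
  by rewrite sc; lia.
by move: np nq; rewrite -!val_eqE /=; lia.
Qed.

Lemma par_right_tperm n (s : 'S_(2 * n)) (p q : 'I_(2 * n)) :
  0 < n -> p = 2 * n - 2 :> nat -> q = 2 * n - 1 :> nat ->
  par_right s = 1 -> par_right (tperm p q * s)%g = 1.
Proof.
move=> n0 ep eq /(par_rightE _ _ n0)[bn [c sc]]; apply/(par_rightE _ _ n0).
split=> //; exists (~~ c) => i i1; rewrite permM.
have in_ := ltn_ord i.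
case: tpermP => [->|->|/eqP np /eqP nq]; first by rewrite sc; lia.
  by rewrite sc; lia.
by move: np nq; rewrite -!val_eqE /=; lia.
Qed.

Lemma tperm_out m (s : 'S_m) (p q i : 'I_m) :
  (i : nat) <> p -> (i : nat) <> q -> (tperm p q * s)%g i = s i.
Proof.
by move=> ip iq; rewrite permM tpermD //; apply/eqP => e; [apply: ip | apply: iq]; rewrite e.
Qed.

(** * The case [a = b = n - 1] *)

(** The first [n - 1] values have parity [c], the last [n - 1] the other, and each middle value has
    the parity of the opposite half: the two middle values are the only exceptions to a parity
    class. *)
Lemma initial_set_middle n (s : 'S_(2 * n)) (p q : 'I_(2 * n)) :
  3 <= n -> par s = (n - 1, n - 1) -> p = n.-1 :> nat -> q = n :> nat ->
  exists c, forall x : 'I_(2 * n),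
    (x \in initial_set s n) = (odd x == c) (+) (x \in [:: s p; s q]).
Proof.
move=> n3 [sa sb] ep eq; have n0 : 0 < n by lia.
have [_ [c lc]] := (par_leftE s _ n0).1 sa.
have [_ [d rd]] := (par_rightE s _ n0).1 sb.
have npq : p != q by rewrite -val_eqE /=; lia.
(* Otherwise [2 * n - 2 > n] entries would share one parity. *)
have dc : d = ~~ c.
  have [e|] := eqVneq c d; last by case: (c) (d) => [] [].
  have : #|~: [set p; q]| <= n.
    apply: (@card_same_parity n s _ c) => i; rewrite !inE negb_or -!val_eqE /= => /andP[ip iq].
    by have [i_n|ni] := ltnP i n; [rewrite lc; lia | rewrite rd -?e; lia].
  by rewrite cardsCs setCK cards2 npq card_ord; lia.
exists c => x; rewrite mem_initial_set !inE -(permKV s x).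
set i := (s^-1)%g x; rewrite permK !(inj_eq (@perm_inj _ s)) -!val_eqE /= ep eq.
have [i_n|ni] := ltnP i n.
  by rewrite lc; lia.
by rewrite rd ?dc; lia.
Qed.

Lemma entry_pair_eq n (s t : 'S_(2 * n)) (p q : 'I_(2 * n)) :
  0 < n -> p = n.-1 :> nat -> q = n :> nat ->
  [:: entry s n; entry s (n + 1)] =i [:: entry t n; entry t (n + 1)] <->
  [:: s p; s q] =i [:: t p; t q].
Proof.
move=> n0 ep eq; pose succ (x : 'I_(2 * n)) := x.+1.
have succ_inj : injective succ by move=> x y [/val_inj].
have pair r : [:: entry r n; entry r (n + 1)] = map succ [:: r p; r q].
  by rewrite /= /succ -!entryE ep eq prednK // addn1.
rewrite !pair; split=> [st x|]; last exact: eq_mem_map.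
by rewrite -!(mem_map succ_inj) st.
Qed.

Lemma path_equiv_middle n (s t : 'S_(2 * n)) :
  3 <= n -> par s = (n - 1, n - 1) -> par t = (n - 1, n - 1) ->
  path_equiv s t <->
  [:: entry s n; entry s (n + 1)] =i [:: entry t n; entry t (n + 1)].
Proof.
move=> n3 sab tab; have n0 : 0 < n by lia.
rewrite (path_equiv_initial n0 sab tab).
have pn : n.-1 < 2 * n by lia.
have qn : n < 2 * n by lia.
set p := Ordinal pn; set q := Ordinal qn.
rewrite (@entry_pair_eq _ _ _ p q) //.
have [c sc] := @initial_set_middle _ s p q n3 sab erefl erefl.
have [d td] := @initial_set_middle _ t p q n3 tab erefl erefl.
split=> [st x|eqi].
  (* The pairs cover at most four of at least six values. A value [y] outside both reveals how [e],
     [c] and [d] are related, which then settles every [x]. *)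
  have [y yl ym] : exists2 y, y \notin [:: s p; s q] & y \notin [:: t p; t q].
    have : ~: [set y in [:: s p; s q] ++ [:: t p; t q]] != set0.
      rewrite -card_gt0 cardsCs setCK card_ord cardsE.
      by rewrite subn_gt0; apply: leq_ltn_trans (card_size _) _; rewrite /=; lia.
    case/set0Pn => y; rewrite in_setC in_set mem_cat negb_or => /andP[yl ym].
    by exists y.
  have [e e_st] : exists e : bool, forall z,
      (z \in initial_set s n) = e (+) (z \in initial_set t n).
    have [|->|[_ ->]] := st n; first by lia.
      by exists false.
    by exists true => z; rewrite inE.
  have := e_st y; have := e_st x; rewrite !sc !td (negbTE yl) (negbTE ym).
  move: (odd x) (odd y) => ox oy.
  by case: (x \in _); case: (x \in _) ox oy => [] [] []; case: (e) (c) (d) => [] [] [].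
move=> k kab; have -> : k = n by lia.
have [cd|cd] := eqVneq c d; [left | right; split=> //]; apply/setP => x;
  rewrite ?[x \in ~: _]inE sc td eqi ?cd //.
by case: (odd x) (c) (d) (x \in _) cd => [] [] [] [].
Qed.

(** * The cases where exactly one of [a], [b] is 1 *)

(** Path equivalence leaves [k = 1] free, while friendship fixes it. Swapping the first two entries
    of [t] stays in its family, keeps the parity, and matches the first entry of [s] when [t] itself
    does not. *)
Lemma path_equiv_par_left1 n (s t : 'S_(2 * n)) a b :
  3 <= n -> par s = (a, b) -> par t = (a, b) -> a = 1 -> b != 1 ->
  path_equiv s t <-> exists2 t' : 'S_(2 * n), t' \in fam t & friends s t'.
Proof.
move=> n3 sab tab a1 nb1.
have n0 : 0 < n by lia.
have n2 : 2 <= n by lia.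
have [sa sb] := (congr1 fst sab, congr1 snd sab).
have [ta tb] := (congr1 fst tab, congr1 snd tab).
rewrite /= in sa sb ta tb.
have [a0 b0] : 0 < a < 2 * n /\ 0 < b < 2 * n.
  by have [] := (par_leftE s a n0).1 sa; have [] := (par_rightE s b n0).1 sb.
have bn : b < n by apply: (par_right_lt n0 sab); lia.
have an : a < n by lia.
rewrite (path_equiv_initial_eq n3 sab tab) //; last by case; lia.
have b2 : 1 < b by lia.
have le_ab : a <= 2 * n - b by lia.
split=> [st|[t' /(famE _ _ n2) tt' /(friendsE _ sab le_ab)[_ st']] k kab]; last first.
  by rewrite st' -?tt' //; lia.
have {}st k : 2 <= k <= 2 * n - b -> initial_set s k = initial_set t k.
  move=> kb; have [->|nk] := eqVneq k (2 * n - b).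
    by apply: (initial_set_par_right n0 sb tb) => //; apply: st; lia.
  by apply: st; lia.
have pn : 0 < 2 * n by lia.
have qn : 1 < 2 * n by lia.
have [||||e1] := @initial_set_tperm_or _ s t (Ordinal pn) (Ordinal qn) => //.
+ by rewrite !initial_set0.
+ by apply: st; rewrite /=; lia.
+ move=> e1; exists t; first by apply/(famE _ _ n2).
  apply/(friendsE _ sab le_ab).
  split=> // k kb; have [->|nk] := eqVneq k 1; first exact: e1.
  by apply: st; lia.
exists (tperm (Ordinal pn) (Ordinal qn) * t)%g.
  apply/(famE _ _ n2) => k k2.
  by rewrite initial_set_tperm //=; lia.
apply/(friendsE _ sab le_ab).
split.
  congr pair; first by rewrite a1; apply: par_left_tperm; rewrite // ta.
  by apply: (par_right_agree n0 tb) => i ib; rewrite tperm_out //=; lia.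
move=> k kb; have [->|nk] := eqVneq k 1; first exact: e1.
by rewrite initial_set_tperm ?st //=; lia.
Qed.

(** Mirror image: the free index is [k = 2 * n - 1], and the last two entries are swapped. *)
Lemma path_equiv_par_right1 n (s t : 'S_(2 * n)) a b :
  3 <= n -> par s = (a, b) -> par t = (a, b) -> a != 1 -> b = 1 ->
  path_equiv s t <-> exists2 t' : 'S_(2 * n), t' \in fam t & friends s t'.
Proof.
move=> n3 sab tab na1 b1.
have n0 : 0 < n by lia.
have n2 : 2 <= n by lia.
have [sa sb] := (congr1 fst sab, congr1 snd sab).
have [ta tb] := (congr1 fst tab, congr1 snd tab).
rewrite /= in sa sb ta tb.
have [a0 b0] : 0 < a < 2 * n /\ 0 < b < 2 * n.
  by have [] := (par_leftE s a n0).1 sa; have [] := (par_rightE s b n0).1 sb.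
have an : a < n by apply: (par_left_lt n0 sab); lia.
have bn : b < n by lia.
rewrite (path_equiv_initial_eq n3 sab tab) //; last by case; lia.
have a2 : 1 < a by lia.
have le_ab : a <= 2 * n - b by lia.
split=> [st|[t' /(famE _ _ n2) tt' /(friendsE _ sab le_ab)[_ st']] k kab]; last first.
  by rewrite st' -?tt' //; lia.
have {}st k : a <= k <= 2 * n - 2 -> initial_set s k = initial_set t k.
  move=> ka; have [->|nk] := eqVneq k a.
    by apply: (initial_set_par_left n0 sa ta) => //; apply: st; lia.
  by apply: st; lia.
have pn : 2 * n - 2 < 2 * n by lia.
have qn : 2 * n - 1 < 2 * n by lia.
have epq : Ordinal qn = (Ordinal pn).+1 :> nat by rewrite /=; lia.
have [|||e1] := @initial_set_tperm_or _ s t _ _ epq.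
+ by apply: st; rewrite /=; lia.
+ by rewrite !initial_setT //=; lia.
+ move=> e1; exists t; first by apply/(famE _ _ n2).
  apply/(friendsE _ sab le_ab).
  split=> // k kb; have [->|nk] := eqVneq k (2 * n - 1); first exact: e1.
  by apply: st; lia.
exists (tperm (Ordinal pn) (Ordinal qn) * t)%g.
  apply/(famE _ _ n2) => k k2.
  by rewrite initial_set_tperm //=; lia.
apply/(friendsE _ sab le_ab).
split.
  congr pair; last by rewrite b1; apply: par_right_tperm; rewrite // tb.
  by apply: (par_left_agree n0 ta) => i ia; rewrite tperm_out //=; lia.
move=> k kb; have [->|nk] := eqVneq k (2 * n - 1); first exact: e1.
by rewrite initial_set_tperm ?st //=; lia.
Qed.

(** * Assembly of the five cases *)

Theorem theorem3 (n : nat) (lambda mu : 'S_(2 * n)) (a b : nat) :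
  3 <= n -> par lambda = (a, b) -> par mu = (a, b) ->
  [/\ a = n /\ b = n -> path_class lambda = path_class mu,
      a = n - 1 /\ b = n - 1 ->
        (path_class lambda = path_class mu <->
         [:: entry lambda n; entry lambda (n + 1)]
           =i [:: entry mu n; entry mu (n + 1)]),
      1 < a <= n - 1 -> 1 < b <= n - 1 -> (a, b) <> (n - 1, n - 1) ->
        (path_class lambda = path_class mu <-> friends lambda mu),
      (a == 1) (+) (b == 1) ->
        (path_class lambda = path_class mu <->
         exists2 mu' : 'S_(2 * n), mu' \in fam mu & friends lambda mu')
    & a = 1 /\ b = 1 ->
        (path_class lambda = path_class mu <-> mu \in fam lambda)].
Proof.
move=> n3 lab mab; have n0 : 0 < n by lia.
have [la lb] := (congr1 fst lab, congr1 snd lab).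
have [ma mb] := (congr1 fst mab, congr1 snd mab).
rewrite /= in la lb ma mb.
split.
(* The range [n < k < n] is empty. *)
- move=> [an bn]; apply/path_class_eq/(path_equiv_initial n0 lab mab) => k; lia.
- move=> [an bn]; rewrite an bn in lab mab; rewrite path_class_eq.
  exact: path_equiv_middle n3 lab mab.
- move=> a1 b1 nab; rewrite path_class_eq (path_equiv_initial_eq n3 lab mab) //; try lia.
  rewrite (friendsE _ lab); last by lia.
  split=> [st|[_ st] k kab]; last by apply: st; lia.
  (* Friendship includes the endpoints [a] and [2 * n - b]; both are recovered because [a] and [b]
     exceed 1. *)
  split=> // k kab; have [->|ka] := eqVneq k a.
    by apply: (initial_set_par_left n0 la ma); [lia | apply: st; lia].
  have [->|kb] := eqVneq k (2 * n - b).
    by apply: (initial_set_par_right n0 lb mb); [lia | apply: st; lia].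
  by apply: st; lia.
- case: (eqVneq a 1) => [a1|na1]; case: (eqVneq b 1) => [b1|nb1] //= _;
    rewrite path_class_eq.
    exact: path_equiv_par_left1 lab mab a1 nb1.
  exact: path_equiv_par_right1 lab mab na1 b1.
- move=> [a1 b1]; rewrite path_class_eq.
  rewrite (path_equiv_initial_eq n3 lab mab); try lia; last by case; lia.
  rewrite famE; last by lia.
  by split=> st k kab; apply: st; lia.
Qed.
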